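(* Let $q$ be a power of an odd prime, let $n\ge 4$ be even, and let $f\in\mathbb{F}_q[x_1,\dots,x_n]$ be a non-degenerate quadratic form such that $(-1)^{n/2}\det(f)$ is not a square in $\mathbb{F}_q^\times$. Let $X=V(f)\subseteq\mathbb{P}^{n-1}$. Then for every integer $P\ge1$: if $n=4$, $$\#\mathrm{Mor}_P(\mathbb{P}^1,X)(\mathbb{F}_q)=\begin{cases}\frac{q^4-1}{q^2}\,q^{2P}&\text{if }2\mid P,\\ 0&\text{if }2\nmid P,\end{cases}$$ and if $n\ge6$, $$\#\mathrm{Mor}_P(\mathbb{P}^1,X)(\mathbb{F}_q)=\frac{(q^{n/2}+1)(q^{n-2}-1)(q^{n-3}-1)}{q^{n-2}(q^{n/2-2}+1)(q-1)}\,q^{P(n-2)}+(-1)^P\frac{(q^{n-2}-1)(q^{n/2}+1)}{q^{n/2}(q^{n/2-2}+1)}\,q^{\frac n2P}.$$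
   Context: $\det(f)$ denotes the determinant of the symmetric matrix $A\in\mathbb{F}_q^{n\times n}$ with $f(\mathbf{x})=\mathbf{x}^TA\mathbf{x}$; non-degenerate means $\det(f)\neq0$. $\#\mathrm{Mor}_P(\mathbb{P}^1,X)(\mathbb{F}_q)$ denotes the number of morphisms $\mathbb{P}^1\to X$ of degree exactly $P$ defined over $\mathbb{F}_q$; equivalently, it is the number of vectors $(x_1,\dots,x_n)\in\mathbb{F}_q[t]^n$ with $\gcd(x_1,\dots,x_n)=1$, $\max_i\deg(x_i)=P$ and $f(x_1,\dots,x_n)=0$, counted modulo multiplication by scalars in $\mathbb{F}_q^\times$ (i.e. this number divided by $q-1$). *)

(* Defs.v *)
From HB Require Import structures.
From mathcomp Require Import all_boot all_order all_algebra.
Set Implicit Arguments. Unset Strict Implicit. Unset Printing Implicit Defensive.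
Import Order.TTheory GRing.Theory Num.Theory.
Local Open Scope ring_scope.

Definition qform_poly (F : fieldType) (n : nat) (A : 'M[F]_n)
  (x : 'I_n -> {poly F}) : {poly F} :=
  \sum_(i < n) \sum_(j < n) A i j *: (x i * x j).

Definition polys_of (F : fieldType) (n P : nat) (M : 'M[F]_(n, P.+1))
  : 'I_n -> {poly F} :=
  fun i => \poly_(j < P.+1) M i (inord j).

Definition gcd_polys (F : fieldType) (n : nat) (x : 'I_n -> {poly F}) : {poly F} :=
  \big[@gcdp F/0]_(i < n) x i.

(* M encodes (x_1,...,x_n) with gcd(x_1,...,x_n) = 1 (i.e. the gcd is a nonzero
   constant), max_i deg x_i = P (exactly), and f(x_1,...,x_n) = 0. *)
Definition is_mor_vec (F : fieldType) (n P : nat) (A : 'M[F]_n)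
  (M : 'M[F]_(n, P.+1)) : bool :=
  [&& size (gcd_polys (polys_of M)) == 1%N,
      [exists i : 'I_n, size (polys_of M i) == P.+1] &
      qform_poly A (polys_of M) == 0].

Definition num_mor (F : finFieldType) (n P : nat) (A : 'M[F]_n) : rat :=
  (#|[set M : 'M[F]_(n, P.+1) | is_mor_vec A M]|%:R) / ((#|F| - 1)%:R).

(* Main.v *)
Require Import Defs.
From HB Require Import structures.
From mathcomp Require Import all_boot all_order all_algebra.
From mathcomp Require Import all_fingroup all_solvable all_field all_character.
From mathcomp Require Import ring zify.
Set Implicit Arguments. Unset Strict Implicit. Unset Printing Implicit Defensive.
Import Order.TTheory GRing.Theory Num.Theory.
Local Open Scope ring_scope.

(** Write n = 2m and let S_k be the number of vectors of polynomials of degree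
    < k on which f vanishes.  Detecting the 2k-1 coefficients of f(x) by an
    additive character gives q^(2k-1) S_k as a sum, over the k x k Hankel
    matrices H, of the Gauss sum of the form H (x) A.  As (-1)^(m) det A is not
    a square, that Gauss sum is (-q^m)^r q^(2m(k-r)) with r = rank H.

    Exactly q^(2r) of the k x k Hankel matrices have rank <= r, for r < k.
    Indeed, the ranks of the r x (2k-r) Hankel matrices of a fixed sequence are
    concave and symmetric in r, hence equal to min(r, rank H) for r <= k, and
    counting the pairs (u, a) with u in the left kernel of the r x (2k-r) Hankel
    matrix of a in two ways then determines the rank distribution.

    Finally, let E_P count the solutions of degree exactly P.  Replacing the
    monic gcd g of a solution by t g + c, with c in F_q, is a bijection from
    F_q x {solutions of degree P-1} to the non-primitive solutions of degree P,
    so there are E_P - q E_(P-1) primitive ones. *)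

(** * Hankel matrices *)

Section Hankel.
Variable F : fieldType.
Implicit Types (a : nat -> F) (r s : nat).

Definition hankel r s a : 'M[F]_(r, s) := \matrix_(i, j) a (i + j)%N.

Lemma tr_hankel r s a : (hankel r s a)^T = hankel s r a.
Proof. by apply/matrixP=> i j; rewrite !mxE addnC. Qed.

(** [u *m embed_mx f] adds coordinate [i] of [u] at position [f i], while [embed_mx f *m H] selects
    rows of [H] along [f]. *)
Definition embed_mx m n (f : 'I_m -> 'I_n) : 'M[F]_(m, n) := rowsub f 1%:M.

Lemma embed_mx_free m n (f : 'I_m -> 'I_n) : injective f -> row_free (embed_mx f).
Proof.
move=> inj_f; apply/row_freeP; exists (embed_mx f)^T.
rewrite mul_rowsub_mx mul1mx; apply/matrixP=> i j.
by rewrite !mxE eq_sym (inj_eq inj_f).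
Qed.

Lemma mul_embed_mxE m n (f : 'I_m -> 'I_n) (u : 'rV_m) k :
  (u *m embed_mx f) 0 k = \sum_(i | f i == k) u 0 i.
Proof.
rewrite mxE [RHS]big_mkcond; apply: eq_bigr => i _.
by rewrite !mxE; case: eqP => _; rewrite ?mulr1 ?mulr0.
Qed.

Lemma mul_embed_mx_inj m n (f : 'I_m -> 'I_n) (u : 'rV_m) i :
  injective f -> (u *m embed_mx f) 0 (f i) = u 0 i.
Proof.
move=> inj_f; rewrite mul_embed_mxE (eq_bigl (pred1 i)) ?big_pred1_eq // => j.
by rewrite (inj_eq inj_f).
Qed.

Local Notation low := (widen_ord (leqnSn _)).
Local Notation high := (lift ord0).

Lemma widen_inj n : injective (fun i : 'I_n => low i).
Proof. by move=> i j /(congr1 val) /= /val_inj. Qed.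

(* A row vector is read as a polynomial in t: [embed_mx low] relaxes the degree
   bound and [embed_mx high] is multiplication by t, so the hypothesis says
   x = t y. *)
Lemma kermx_hankel_cap r s a (x y : 'rV_r.+1) :
    x *m hankel r.+1 s.+1 a = 0 -> y *m hankel r.+1 s.+1 a = 0 ->
    x *m embed_mx (fun i => low i) = y *m embed_mx high ->
  exists2 w : 'rV_r, w *m hankel r s.+2 a = 0 & x = w *m embed_mx high.
Proof.
move=> xH yH exy.
have injl := @lift_inj; have injw := widen_inj.
have x0 : x 0 0 = 0.
  rewrite -(mul_embed_mx_inj x 0 (injw _)) exy mul_embed_mxE big1 // => i /eqP/(congr1 val).
have ymax : y 0 ord_max = 0.
  rewrite -(mul_embed_mx_inj y ord_max (@injl _ ord0)) -exy mul_embed_mxE.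
  rewrite big1 // => i /eqP/(congr1 val) /= [ei].
  by have := ltn_ord i; rewrite ei ltnn.
have xy (i : 'I_r) : x 0 (high i) = y 0 (low i).
  rewrite -(mul_embed_mx_inj x _ (injw _)) exy.
  rewrite -(mul_embed_mx_inj y _ (@injl _ ord0)).
  by congr (_ 0 _); apply/val_inj.
(* The witness is [y] without its zero top coefficient, so x = t w. Columns 0 to [s] of its equation
   come from [yH], the last one from [xH]. *)
exists (\row_i y 0 (low i)).
  apply/rowP=> j; rewrite !mxE; case: (unliftP ord_max j) => [k|] ->.
    move/rowP/(_ k): yH; rewrite !mxE big_ord_recr /= ymax mul0r addr0 => {2}<-.
    by apply: eq_bigr => i _; rewrite !mxE /= /bump leqNgt ltn_ord.
  move/rowP/(_ ord_max): xH; rewrite !mxE big_ord_recl /= x0 mul0r add0r => {2}<-.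
  by apply: eq_bigr => i _; rewrite !mxE xy /= /bump add1n addSnnS.
apply/rowP=> j; case: (unliftP ord0 j) => [k|] ->.
  by rewrite mul_embed_mx_inj ?mxE //; apply: injl.
rewrite mul_embed_mxE big1 => [|i /eqP/(congr1 val) //].
by rewrite -x0; congr (x 0 _); apply/val_inj.
Qed.

(** Let [K] be the left kernel in the middle shape. Both [K] and t [K] lie in the left kernel of the
    shape with one more row, and by [kermx_hankel_cap] their intersection is no larger than the left
    kernel of the shape with one row less. The dimension formula for sum and intersection
    concludes. *)
Lemma rank_hankel_concave r s a :
  (\rank (hankel r.+2 s a) + \rank (hankel r s.+2 a)
     <= (\rank (hankel r.+1 s.+1 a)).*2)%N.
Proof.
pose K := kermx (hankel r.+1 s.+1 a).
pose U := K *m embed_mx (fun i => low i); pose V := K *m embed_mx high.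
have rU : \rank U = \rank K by rewrite mxrankMfree // embed_mx_free //; apply: widen_inj.
have rV : \rank V = \rank K by rewrite mxrankMfree // embed_mx_free //; apply: lift_inj.
have K0 : K *m hankel r.+1 s.+1 a = 0 by apply: mulmx_ker.
have sUV : (U + V <= kermx (hankel r.+2 s a))%MS.
  rewrite addsmx_sub; apply/andP; split; apply/sub_kermxP/matrixP=> i j.
    rewrite -mulmxA mul_rowsub_mx mul1mx.
    move/matrixP/(_ i (low j)): K0; rewrite !mxE => {2}<-.
    by apply: eq_bigr => k _; rewrite !mxE.
  rewrite -mulmxA mul_rowsub_mx mul1mx.
  move/matrixP/(_ i (high j)): K0; rewrite !mxE => {2}<-.
  by apply: eq_bigr => k _; rewrite !mxE /= /bump !add1n addSnnS.
have sUV' : (U :&: V <= kermx (hankel r s.+2 a)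
                 *m (embed_mx high *m embed_mx (fun i => low i)))%MS.
  apply/rV_subP=> u; rewrite sub_capmx => /andP[/submxP[x ux] /submxP[y uy]].
  have xK : (x *m K) *m hankel r.+1 s.+1 a = 0 by rewrite -mulmxA K0 mulmx0.
  have yK : (y *m K) *m hankel r.+1 s.+1 a = 0 by rewrite -mulmxA K0 mulmx0.
  have [|w wH xw] := kermx_hankel_cap xK yK; first by rewrite -[LHS]mulmxA -[RHS]mulmxA -[RHS]uy; exact: (esym ux).
  rewrite ux /U mulmxA xw -mulmxA submxMr //; exact/sub_kermxP.
have := mxrank_sum_cap U V.
have := mxrankS sUV; have := leq_trans (mxrankS sUV') (mxrankM_maxl _ _).
have := rank_leq_row (hankel r.+2 s a).
have := rank_leq_row (hankel r s.+2 a).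
have := rank_leq_row (hankel r.+1 s.+1 a).
rewrite rU rV !mxrank_ker; lia.
Qed.

End Hankel.

(** Equal values on both sides of [k.+1] make the increment before it nonnegative, hence by
    concavity all earlier ones. Being at most 1 and nonincreasing, the increments are ones followed
    by zeros. *)
Lemma concave_min (u : nat -> nat) k : u 0%N = 0%N -> (u 1%N <= 1)%N ->
    (forall i, (i <= k)%N -> (u i.+2 + u i <= (u i.+1).*2)%N) -> u k.+2 = u k ->
  forall i, (i <= k.+1)%N -> u i = minn i (u k.+1).
Proof.
move=> u0 u1 cu uk.
have mono i : (i <= k)%N -> (u (k - i)%N <= u (k - i).+1)%N.
  elim: i => [|i IH] ik; first by rewrite subn0; have := cu k (leqnn _); lia.
  have := IH (ltnW ik); have := cu (k - i.+1)%N (leq_subr _ _).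
  have -> : (k - i = (k - i.+1).+1)%N by lia.
  lia.
have {}mono i : (i <= k)%N -> (u i <= u i.+1)%N.
  by move=> ik; have := mono (k - i)%N (leq_subr _ _); rewrite subKn.
have step i : (i <= k)%N -> u i.+1 = u i \/ u i.+1 = i.+1 /\ u i = i.
  elim: i => [_|i IH ik]; first by lia.
  by have := IH (ltnW ik); have := cu i (ltnW ik); have := mono i.+1 ik; lia.
have le_id i : (i <= k.+1)%N -> (u i <= i)%N.
  elim: i => [|i IH] ik; first by rewrite u0.
  by have := IH (ltnW ik); have := step i ik; lia.
have P j : (j <= k.+1)%N -> u (k.+1 - j)%N = (k.+1 - j)%N \/ u (k.+1 - j)%N = u k.+1.
  elim: j => [|j IH] jk; first by right; rewrite subn0.
  have := IH (ltnW jk); have := step (k - j)%N (leq_subr _ _).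
  have := le_id (k - j)%N (leqW (leq_subr _ _)).
  by rewrite subSS subSn //; lia.
have le_last j : (j <= k.+1)%N -> (u (k.+1 - j)%N <= u k.+1)%N.
  elim: j => [|j IH] jk; first by rewrite subn0.
  by rewrite subSS; apply: leq_trans (mono _ (leq_subr _ _)) _; rewrite -subSn // IH // ltnW.
move=> i ik; have := le_id i ik; have := P (k.+1 - i)%N (leq_subr _ _).
by have := le_last (k.+1 - i)%N (leq_subr _ _); rewrite subKn //; lia.
Qed.

(** * Rank distribution of Hankel matrices over a finite field *)

Section HankelCount.
Variable F : finFieldType.

Local Notation coefs a := (nth 0 (polyseq (rVpoly a))).

(** Transposition exchanges the shapes with i and 2(k+1) - i rows, which gives the symmetry required
    by [concave_min]. *)
Lemma rank_hankel_profile (a : nat -> F) k r : (r <= k.+1)%N ->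
  \rank (hankel r (k.+1.*2 - r) a) = minn r (\rank (hankel k.+1 k.+1 a)).
Proof.
pose u i := \rank (hankel i (k.+1.*2 - i) a).
have -> : \rank (hankel k.+1 k.+1 a) = u k.+1 by rewrite /u -addnn addnK.
apply: (@concave_min u k).
- by apply/eqP; rewrite -leqn0 rank_leq_row.
- exact: rank_leq_row.
- move=> i ik; rewrite /u.
  have -> : (k.+1.*2 - i.+2 = k.*2 - i)%N by lia.
  have -> : (k.+1.*2 - i.+1 = (k.*2 - i).+1)%N by lia.
  have -> : (k.+1.*2 - i = (k.*2 - i).+2)%N by lia.
  exact: rank_hankel_concave.
rewrite /u -mxrank_tr tr_hankel.
have -> : (k.+1.*2 - k.+2 = k)%N by lia.
by have -> : (k.+1.*2 - k = k.+2)%N by lia.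
Qed.

Lemma card_left_kernel m n (A : 'M[F]_(m, n)) :
  #|[set u : 'rV_m | u *m A == 0]| = (#|F| ^ (m - \rank A))%N.
Proof.
rewrite -mxrank_ker -card_rowg; apply: eq_card => u.
by rewrite inE mem_rowg (sameP sub_kermxP eqP).
Qed.

Lemma rVpolyE d (v : 'rV[F]_d) : rVpoly v = \sum_i v 0 i *: 'X^i.
Proof.
rewrite [rVpoly v]poly_def; apply: eq_bigr => i _.
by rewrite valK.
Qed.

(** The condition on [a] is linear, its equations being the coefficient vectors of u, t u, ...,
    t^(s-1) u. They are independent since v u = 0 forces v = 0, which leaves dimension N - s = r -
    1. *)
Lemma card_hankel_annihilated r s N (u : 'rV[F]_r) : N.+1 = (r + s)%N -> u != 0 ->
  #|[set a : 'rV_N | u *m hankel r s (coefs a) == 0]| = (#|F| ^ r.-1)%N.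
Proof.
move=> Nrs u0.
pose M : 'M[F]_(N, s) := \matrix_(l, j) \sum_i u 0 i *+ (l == i + j :> nat)%N.
have uHE (a : 'rV_N) : u *m hankel r s (coefs a) = a *m M.
  apply/rowP=> j; rewrite !mxE.
  under [RHS]eq_bigr do rewrite mxE big_distrr /=.
  rewrite exchange_big /=; apply: eq_bigr => i _; rewrite mxE.
  have ijN : (i + j < N)%N by have := ltn_ord i; have := ltn_ord j; lia.
  rewrite (bigD1 (Ordinal ijN)) //= eqxx big1 ?addr0 => [|l /eqP nl].
    by rewrite mulrC -(coef_rVpoly_ord a (Ordinal ijN)).
  rewrite (_ : (l == _ :> nat) = false) ?mulr0 //.
  by apply/eqP=> e; case: nl; apply/val_inj.
(* [v *m M^T] lists the coefficients of the product of the polynomials of [v] and [u]. *)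
have Mfree : row_free M^T.
  apply: inj_row_free => v vM.
  have vu : rVpoly v * rVpoly u = 0.
    have -> : rVpoly v * rVpoly u = \sum_j \sum_i (v 0 j * u 0 i) *: 'X^(j + i).
      rewrite !rVpolyE big_distrl; apply: eq_bigr => j _.
      rewrite big_distrr; apply: eq_bigr => i _ /=.
      by rewrite -scalerAl -scalerAr -exprD scalerA.
    apply/polyP=> l; rewrite coef0 coef_sum.
    under eq_bigr do rewrite coef_sum.
    have [lN|Nl] := ltnP l N.
      move/rowP/(_ (Ordinal lN)): vM; rewrite !mxE => e; rewrite -[RHS]e.
      apply: eq_bigr => j _; rewrite !mxE big_distrr; apply: eq_bigr => i _ /=.
      by rewrite coefZ coefXn addnC -mulrA mulr_natr.
    rewrite big1 // => j _; rewrite big1 // => i _.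
    rewrite coefZ coefXn; case: eqP => [e|_]; last by rewrite mulr0.
    by have := ltn_ord i; have := ltn_ord j; lia.
  have /eqP := vu; rewrite mulf_eq0 => /orP[]/eqP e0.
    by rewrite -[v]rVpolyK e0 linear0.
  by case/eqP: u0; rewrite -[u]rVpolyK e0 linear0.
transitivity #|[set a : 'rV_N | a *m M == 0]|.
  by apply: eq_card => a; rewrite !inE uHE.
rewrite card_left_kernel -mxrank_tr (eqP Mfree); congr (_ ^ _)%N; lia.
Qed.

Lemma card_rV n : #|{: 'rV[F]_n}| = (#|F| ^ n)%N.
Proof. by rewrite card_mx mul1n. Qed.

(** Double count of the pairs (u, a) with [u] in the left kernel: u = 0 contributes q^N, every other
    [u] contributes q^(r-1). *)
Lemma sum_kernel_hankel r s N : N.+1 = (r + s)%N ->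
  (\sum_(a : 'rV[F]_N) #|F| ^ (r - \rank (hankel r s (coefs a)))
     = #|F| ^ N + (#|F| ^ r - 1) * #|F| ^ r.-1)%N.
Proof.
move=> Nrs.
transitivity (\sum_(a : 'rV[F]_N) \sum_(u : 'rV[F]_r) (u *m hankel r s (coefs a) == 0)%R)%N.
  apply: eq_bigr => a _; rewrite -card_left_kernel -sum1dep_card big_mkcond /=.
  by apply: eq_bigr => u _; case: eqP.
rewrite exchange_big (bigD1 0) //=; congr (_ + _)%N.
  under eq_bigr do rewrite mul0mx eqxx.
  by rewrite sum1_card card_rV.
rewrite (eq_bigr (fun=> #|F| ^ r.-1)%N) => [|u u0].
  by rewrite sum_nat_const cardC1 card_rV subn1.
rewrite -(card_hankel_annihilated Nrs u0) -sum1dep_card [RHS]big_mkcond /=.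
by apply: eq_bigr => a _; case: eqP.
Qed.

Lemma card_hankel_rank_le k r : (r <= k)%N ->
  #|[set a : 'rV[F]_(k.*2.+1) | (\rank (hankel k.+1 k.+1 (coefs a)) <= r)%N]|
    = (#|F| ^ r.*2)%N.
Proof.
move=> rk; pose rho (a : 'rV[F]_(k.*2.+1)) := \rank (hankel k.+1 k.+1 (coefs a)).
have S i : (i <= k.+1)%N ->
    (\sum_(a : 'rV[F]_(k.*2.+1)) #|F| ^ (i - minn i (rho a))
       = #|F| ^ k.*2.+1 + (#|F| ^ i - 1) * #|F| ^ i.-1)%N.
  move=> ik; rewrite -(@sum_kernel_hankel i (k.+1.*2 - i)); last by lia.
  by apply: eq_bigr => a _; rewrite rank_hankel_profile.
have q1 : (1 < #|F|)%N := finNzRing_gt1 F.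
pose C := (\sum_(a : 'rV[F]_(k.*2.+1)) (r < rho a))%N.
(* Passing from [r] to [r.+1] multiplies a term by q, except where the rank exceeds [r]: there both
   terms are 1. The defect isolates [C]. *)
have eC : (\sum_(a : 'rV[F]_(k.*2.+1)) #|F| ^ (r.+1 - minn r.+1 (rho a)) + (#|F| - 1) * C
     = #|F| * \sum_(a : 'rV[F]_(k.*2.+1)) #|F| ^ (r - minn r (rho a)))%N.
  rewrite !big_distrr -big_split /=; apply: eq_bigr => a _.
  have [lt_r|ge_r] := ltnP r (rho a).
    by rewrite (minn_idPl lt_r) !subnn expn0 !muln1 subnKC // ltnW.
  by rewrite (minn_idPr (leqW ge_r)) subSn // expnS muln0 addn0.
have cardC : (#|[set a : 'rV[F]_(k.*2.+1) | (rho a <= r)%N]| + C = #|F| ^ k.*2.+1)%N.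
  rewrite -sum1dep_card -card_rV -sum1_card big_mkcond -big_split /=.
  by apply: eq_bigr => a _; case: ltnP.
move: eC; rewrite !S //; last by exact: leqW.
have x0 : (0 < #|F| ^ r)%N by rewrite expn_gt0 (ltnW q1).
(* At r = 0 the truncated [r.-1] is harmless, its cofactor q^0 - 1 being 0. *)
have -> : (#|F| * (#|F| ^ k.*2.+1 + (#|F| ^ r - 1) * #|F| ^ r.-1)
    = #|F| * #|F| ^ k.*2.+1 + (#|F| ^ r - 1) * #|F| ^ r)%N.
  by rewrite mulnDr mulnCA; case: (r) => [|i]; rewrite ?expn0 ?subnn ?mul0n //= -(expnS _ i).
rewrite -cardC -(addnn r) expnD /= expnS {S cardC}; move: #|[set a | _]| @C => T; move: (\sum_a _)%N => C /=.
case: (#|F| ^ r)%N x0 => // x _; case: #|F| q1 => // -[//|p] _.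
rewrite !subn1 /=; nia.
Qed.

End HankelCount.

(** * Diagonalization of symmetric matrices *)

Section Diagonalization.
Variable F : fieldType.
Hypothesis two_neq0 : 2%:R != 0 :> F.

(** Polarization: when the diagonal vanishes, the form takes the value 2 [A i j] at e_i + e_j. *)
Lemma sym_anisotropic n (A : 'M[F]_n) : A^T = A -> A != 0 ->
  exists v : 'rV_n, (v *m A *m v^T) 0 0 != 0.
Proof.
move=> symA A0.
have E (i j : 'I_n) : (delta_mx 0 i : 'rV_n) *m A *m (delta_mx 0 j)^T = (A i j)%:M.
  by rewrite -rowE trmx_delta -colE; apply/matrixP=> k l; rewrite !ord1 !mxE eqxx.
have [/existsP[i Aii]|] := boolP [exists i, A i i != 0].
  by exists (delta_mx 0 i); rewrite E mxE.
rewrite negb_exists => /forallP diag0.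
have {}diag0 i : A i i = 0 by apply/eqP; have := diag0 i; rewrite negbK.
have [/existsP[i /existsP[j Aij]]|] := boolP [exists i, exists j, A i j != 0].
  exists (delta_mx 0 i + delta_mx 0 j).
  rewrite linearD /= !mulmxDl !mulmxDr !E !mxE !diag0 /= !mulr1n add0r addr0.
  by rewrite -{2}symA mxE -mulr2n -mulr_natl mulf_neq0.
rewrite negb_exists => /forallP A00; case/eqP: A0; apply/matrixP=> i j; rewrite mxE.
by have := A00 i; rewrite negb_exists => /forallP/(_ j); rewrite negbK => /eqP.
Qed.

(** Completing an anisotropic vector to a basis and clearing its row and column leaves the Schur
    complement [S], to which induction applies. *)
Lemma sym_diagonalizable n (A : 'M[F]_n) : A^T = A ->
  exists2 L, L \in unitmx & exists d, A = L^T *m diag_mx d *m L.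
Proof.
elim: n A => [|n IHn] A symA.
  by exists 1%:M; rewrite ?unitmx1 //; exists 0; rewrite [LHS]flatmx0 [RHS]flatmx0.
have [->|A0] := eqVneq A 0.
  by exists 1%:M; rewrite ?unitmx1 //; exists 0; rewrite linear0 mulmx0 mul0mx.
have [v vAv] := sym_anisotropic symA A0.
(* All rows of [f] are [v] merely so that the first basis vector goes to [v]; [complete_unitmx] then
   yields an invertible [g] with first row [v]. *)
pose f : 'M_n.+1 := \matrix_(i, j) v 0 j.
have e0f : delta_mx 0 0 *m f = v :> 'rV_n.+1.
  by rewrite -rowE; apply/rowP=> j; rewrite !mxE.
have v0 : v != 0 by apply: contraNneq vAv => ->; rewrite !mul0mx mxE.
have [|g g_unit e0g] := @complete_unitmx _ 1 n.+1 (delta_mx 0 0) f.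
  by rewrite e0f mxrank_delta rank_rV v0.
rewrite {}e0f in e0g.
pose B : 'M_(1 + n) := g *m A *m g^T.
have symB : B^T = B by rewrite /B !trmx_mul trmxK symA mulmxA.
have B00 : ulsubmx B = (v *m A *m v^T) 0 0 *: 1%:M.
  rewrite e0g trmx_mul (_ : _ *m _ = delta_mx 0 0 *m B *m (delta_mx 0 0)^T).
    2: by rewrite /B !mulmxA.
  rewrite trmx_delta -rowE -colE.
  apply/matrixP=> i j; rewrite !ord1 !mxE mulr1.
  by rewrite (_ : lshift n 0 = 0) //; apply/val_inj.
set a := (_ 0 0) in vAv B00; pose b := ursubmx B.
have bT : dlsubmx B = b^T by rewrite /b trmx_ursub symB.
pose S := drsubmx B - a^-1 *: (b^T *m b).
have symS : S^T = S.
  by rewrite /S linearB linearZ /= trmx_mul trmxK trmx_drsub symB.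
have [L L_unit [d SE]] := IHn S symS.
pose T : 'M_(1 + n) := block_mx 1%:M (a^-1 *: b) 0 1%:M.
pose W : 'M_(1 + n) := block_mx 1%:M 0 0 L *m T.
have W_unit : W \in unitmx.
  rewrite unitmx_mul; apply/andP; split; rewrite unitmxE ?det_ublock ?det_lblock.
    by rewrite det1 mul1r -unitmxE.
  by rewrite !det1 mul1r unitr1.
pose D : 'rV_(1 + n) := row_mx a%:M d.
have DE : diag_mx D = block_mx (a *: 1%:M) 0 0 (diag_mx d).
  rewrite /D diag_mx_row; congr (block_mx _ _ _ _).
  by apply/matrixP=> i j; rewrite !ord1 !mxE eqxx mulr1.
have BE : B = W^T *m diag_mx D *m W.
  rewrite /W trmx_mul -!mulmxA (mulmxA (diag_mx D)) (mulmxA (block_mx _ _ _ _)^T).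
  rewrite DE !tr_block_mx !trmx0 !trmx1 !mulmx_block.
  rewrite !(mulmx0, mul0mx, mulmx1, mul1mx, add0r, addr0) (mulmxA L^T) -SE.
  rewrite -[LHS]submxK B00 bT -/b linearZ /= -!scalemxAl -!scalemxAr.
  rewrite !mul1mx !mulmx1 (_ : (a^-1 *: b)^T = a^-1 *: b^T) -?scalemxAl; last by rewrite linearZ.
  have aVK C m (M : 'M_(C, m)) : a^-1 *: (a *: M) = M by rewrite scalerA mulVf ?scale1r.
  have aKV C m (M : 'M_(C, m)) : a *: (a^-1 *: M) = M by rewrite scalerA mulfV ?scale1r.
  by rewrite !(aVK, aKV) addrC subrK.
exists (W *m invmx g^T); first by rewrite unitmx_mul W_unit unitmx_inv unitmx_tr.
exists D; transitivity ((invmx g^T)^T *m B *m invmx g^T); last first.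
  by rewrite BE (trmx_mul W) !mulmxA.
by rewrite trmx_inv trmxK /B mulmxA mulmxK ?unitmx_tr // mulKmx.
Qed.

Lemma rank_diag_mx n (d : 'rV[F]_n) : \rank (diag_mx d) = (\sum_j (d 0 j != 0)%R)%N.
Proof.
elim: n d => [|n IHn] d; first by rewrite [diag_mx d]flatmx0 mxrank0 big_ord0.
have E (u : 'rV[F]_(1 + n)) : \rank (diag_mx u) = (\sum_j (u 0 j != 0)%R)%N.
  rewrite -(hsubmxK u) diag_mx_row rank_diag_block_mx.
  rewrite IHn big_split_ord big_ord1 row_mxEl.
  congr (_ + _)%N; last by apply: eq_bigr => j _; rewrite row_mxEr.
  rewrite rank_rV; congr (nat_of_bool (~~ _)).
  apply/eqP/eqP=> [/matrixP/(_ 0 0)|e]; first by rewrite !mxE eqxx.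
  by apply/matrixP=> i j; rewrite !ord1 [LHS]mxE e mul0rn mxE.
exact: E d.
Qed.

End Diagonalization.

(** * Quadratic Gauss sums *)

Section Squares.
Variable F : finFieldType.
Implicit Types a b : F.

Definition issq a := [exists y, y ^+ 2 == a].

Lemma issqP a : reflect (exists y, y ^+ 2 = a) (issq a).
Proof. by apply: (iffP existsP) => -[y /eqP]; exists y => //; apply/eqP. Qed.

Lemma unit_generator : exists g : F, forall a, a != 0 -> exists i, a = g ^+ i.
Proof.
have /cyclicP[x xE] := field_unit_group_cyclic [set: {unit F}].
exists (\val x) => a a0.
have a_unit : a \is a GRing.unit by rewrite unitfE.
have : FinRing.unit F a_unit \in <[x]>%g by rewrite -xE inE.
by case/cycleP=> i /(congr1 val); rewrite FinRing.val_unitX; exists i.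
Qed.

(** Two nonsquares are odd powers of a generator of the unit group, so their product is an even
    power. The other cases only use that the nonzero squares form a group. *)
Lemma issqM a b : a != 0 -> b != 0 -> issq (a * b) = (issq a == issq b).
Proof.
move=> a0 b0.
have sqM c d : issq c -> issq d -> issq (c * d).
  by move=> /issqP[y <-] /issqP[z <-]; apply/issqP; exists (y * z); rewrite exprMn.
have sqMr c d : c != 0 -> issq c -> issq (c * d) -> issq d.
  move=> c0 sc scd; rewrite (_ : d = c^-1 ^+ 2 * (c * (c * d))).
    by apply: (sqM) => //; [apply/issqP; exists c^-1 | apply: (sqM)].
  by field.
have [sa|na] := boolP (issq a); have [sb|nb] := boolP (issq b).
- exact: sqM.
- by apply: contraNF nb; apply: sqMr.
- by apply: contraNF na; rewrite mulrC; apply: sqMr.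
have [g gE] := unit_generator; have [i ai] := gE a a0; have [j bj] := gE b b0.
have odd_exp k : ~~ issq (g ^+ k) -> odd k.
  apply: contraR => even_k; apply/issqP; exists (g ^+ k./2).
  by rewrite -exprM muln2 even_halfK.
rewrite ai bj -exprD; apply/contraT => /odd_exp.
by rewrite oddD !odd_exp // -?ai -?bj.
Qed.

End Squares.

(** The additive group is abelian of order greater than 1, hence has a nontrivial linear character.
    Its sum is unchanged when multiplied by a character value different from 1, so it vanishes. *)
Lemma nontrivial_additive_character (F : finFieldType) :
  exists psi : F -> algC,
    [/\ psi 0 = 1, {morph psi : a b / a + b >-> a * b} & \sum_a psi a = 0].
Proof.
have lin := char_abelianP [set: F] (FinRing.zmod_abelian _).
have [i i0] : exists i : Iirr [set: F], i != 0.
  apply/existsP; rewrite -negb_forall; apply/negP => /forallP all0.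
  have : #|Iirr [set: F]| = 1%N.
    by apply: (@eq_card1 _ (0 : Iirr _)) => j; rewrite !inE all0.
  rewrite card_Iirr_abelian ?FinRing.zmod_abelian // cardsT => q1.
  by have := finNzRing_gt1 F; rewrite q1.
have psiM : {morph 'chi_i : a b / a + b >-> a * b}.
  by move=> a b; rewrite -FinRing.zmodMgE lin_charM ?inE.
exists 'chi_i; split=> //; first exact: lin_char1 (lin i).
have [b psib] : exists b, 'chi_i b != 1.
  apply/existsP; apply: contraR i0; rewrite negb_exists => /forallP psi1.
  rewrite -irr_eq1; apply/eqP/cfunP=> x; rewrite cfun1E inE.
  by apply/eqP; have := psi1 x; rewrite negbK.
apply/eqP; have: (1 - 'chi_i b) * \sum_a 'chi_i a == 0.
  rewrite mulrBl mul1r subr_eq0 big_distrr (reindex_inj (addrI b)) /=; apply/eqP.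
  by apply: eq_bigr => a _; rewrite psiM.
by rewrite mulf_eq0 subr_eq0 eq_sym (negPf psib).
Qed.

Section GaussSums.
Variables (F : finFieldType) (psi : F -> algC).
Hypothesis two_neq0 : 2%:R != 0 :> F.
Hypothesis psi0 : psi 0 = 1.
Hypothesis psiD : {morph psi : a b / a + b >-> a * b}.
Hypothesis sum_psi : \sum_a psi a = 0.
Local Notation q := (#|F|%:R : algC).

Definition gauss a := \sum_y psi (a * y ^+ 2).

(** The quadratic character, but with value 1 at 0, since 0 counts as a square. *)
Definition qchar (a : F) : algC := (-1) ^+ ~~ issq a.

Lemma psi_sum I (r : seq I) (P : pred I) (E : I -> F) :
  psi (\sum_(i <- r | P i) E i) = \prod_(i <- r | P i) psi (E i).
Proof. exact: (big_morph psi psiD psi0). Qed.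

Lemma sum_psiM c : \sum_a psi (a * c) = if c == 0 then q else 0.
Proof.
case: eqP => [->|/eqP c0].
  by under eq_bigr do rewrite mulr0 psi0; rewrite sumr_const.
by rewrite -[RHS]sum_psi [RHS](reindex_inj (mulIf c0)).
Qed.

Lemma gauss0 : gauss 0 = q.
Proof. by rewrite /gauss; under eq_bigr do rewrite mul0r psi0; rewrite sumr_const. Qed.

Lemma gauss_square a b : b != 0 -> gauss (a * b ^+ 2) = gauss a.
Proof.
move=> b0; rewrite /gauss [RHS](reindex_inj (mulfI b0)).
by apply: eq_bigr => y _; congr psi; ring.
Qed.

Lemma card_sqrt (c : F) : #|[set y : F | y ^+ 2 == c]| = if c == 0 then 1%N else (issq c).*2.
Proof.
have [->|c0] := eqVneq c 0.
  rewrite (_ : [set y | _] = [set 0]) ?cards1 //; apply/setP=> y.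
  by rewrite !inE sqrf_eq0.
have [/issqP[b bc]|nsq] := boolP (issq c); last first.
  apply/eqP; rewrite /= cards_eq0 -subset0; apply/subsetP=> y; rewrite !inE => yc.
  by case/negP: nsq; apply/existsP; exists y.
have b0 : b != 0 by apply: contraNneq c0 => b0; rewrite -bc b0 expr0n.
rewrite (_ : [set y | _] = [set b; - b]).
  rewrite cards2 (_ : b != - b) //; apply: contra b0.
  by rewrite -subr_eq0 opprK -mulr2n -mulr_natl mulf_eq0 (negPf two_neq0).
by apply/setP=> y; rewrite !inE -bc eqf_sqr.
Qed.

Lemma gauss_fiber a : a != 0 ->
  gauss a = \sum_c psi c *+ #|[set y : F | y ^+ 2 == c / a]|.
Proof.
move=> a0; rewrite /gauss (partition_big (fun y => a * y ^+ 2) xpredT) //=.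
apply: eq_bigr => c _; rewrite (eq_bigr (fun=> psi c)) => [|y /eqP -> //].
rewrite sumr_const; congr (_ *+ _); apply: eq_card => y; rewrite !inE unfold_in /=.
by apply/eqP/eqP=> [<-|->]; field.
Qed.

Lemma issq1 : issq (1 : F).
Proof. by apply/issqP; exists 1; rewrite expr1n. Qed.

(* Every element is represented exactly twice in total by y^2 and a y^2. *)
Lemma gauss_nonsquare a : a != 0 -> ~~ issq a -> gauss a = - gauss 1.
Proof.
move=> a0 nsq; apply/eqP; rewrite -addr_eq0 !gauss_fiber ?oner_neq0 //.
rewrite -big_split /= (eq_bigr (fun c => psi c *+ 2)) => [|c _].
  by rewrite sumrMnl sum_psi mul0rn.
rewrite -mulrnDr divr1; congr (_ *+ _); rewrite !card_sqrt mulf_eq0 invr_eq0 (negPf a0) orbF.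
have [//|c0] := eqVneq c 0; have ca0 : c / a != 0 by rewrite mulf_neq0 ?invr_eq0.
have := issqM ca0 a0; rewrite divfK // (negPf nsq) => ->.
by case: (issq (c / a)).
Qed.

Lemma gaussE a : a != 0 -> gauss a = qchar a * gauss 1.
Proof.
move=> a0; rewrite /qchar; have [/issqP[b ba]|nsq] := boolP (issq a); last first.
  by rewrite gauss_nonsquare // expr1 mulN1r.
have b0 : b != 0 by apply: contraNneq a0 => b0; rewrite -ba b0 expr0n.
by rewrite expr0 mul1r -{1}ba -[b ^+ 2]mul1r gauss_square.
Qed.

(** Putting x = y + u in x^2 - y^2 gives u^2 + 2 u y, and the sum over y vanishes unless u = 0. *)
Lemma gauss1N1 : gauss 1 * gauss (- 1) = q.
Proof.
transitivity (\sum_y \sum_u psi (u ^+ 2) * psi (y * (u *+ 2))).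
  rewrite mulrC big_distrl; apply: eq_bigr => y _.
  rewrite big_distrr (reindex_inj (addrI y)) /=; apply: eq_bigr => u _.
  by rewrite -!psiD; congr psi; ring.
rewrite exchange_big (bigD1 0) //= [X in _ + X]big1 => [|u u0].
  by rewrite -mulr_sumr sum_psiM mul0rn eqxx expr0n psi0 mul1r addr0.
by rewrite -mulr_sumr sum_psiM -(mulr_natl u) mulf_eq0 (negPf two_neq0) (negPf u0) mulr0.
Qed.

Lemma qcharM a b : a != 0 -> b != 0 -> qchar (a * b) = qchar a * qchar b.
Proof.
by move=> a0 b0; rewrite /qchar issqM //; case: (issq a); case: (issq b);
  rewrite ?expr0 ?expr1 ?mulrN1 ?opprK ?mulr1.
Qed.

Lemma qchar1 : qchar 1 = 1.
Proof. by rewrite /qchar issq1. Qed.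

Lemma qcharX a k : a != 0 -> qchar (a ^+ k) = qchar a ^+ k.
Proof.
move=> a0; elim: k => [|k IH]; first by rewrite !expr0 qchar1.
by rewrite !exprS qcharM ?expf_neq0 // IH.
Qed.

Lemma qchar_sqr a : qchar a ^+ 2 = 1.
Proof. by rewrite /qchar; case: (issq a); rewrite ?sqrrN expr1n. Qed.

Lemma qchar_prod I (r : seq I) (E : I -> F) : (forall i, E i != 0) ->
  qchar (\prod_(i <- r) E i) = \prod_(i <- r) qchar (E i).
Proof.
move=> E0; elim: r => [|i r IH]; first by rewrite !big_nil qchar1.
rewrite !big_cons qcharM ?IH //.
by apply: (big_ind (fun x => x != 0)) => //; [exact: oner_neq0 | exact: mulf_neq0].
Qed.

Lemma gauss1_sqr : gauss 1 ^+ 2 = qchar (- 1) * q.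
Proof.
rewrite -gauss1N1 (@gaussE (-1)) ?oppr_eq0 ?oner_neq0 //.
by rewrite -[LHS]mul1r -(qchar_sqr (-1)); ring.
Qed.

Lemma prod_gauss m (e : 'I_m.*2 -> F) d : d != 0 -> (forall i, e i != 0) ->
  \prod_i gauss (d * e i) = qchar ((-1) ^+ m * \prod_i e i) * q ^+ m.
Proof.
move=> d0 e0; have N1 : -1 != 0 :> F by rewrite oppr_eq0 oner_neq0.
have pe0 : \prod_i e i != 0 by apply/prodf_neq0.
under eq_bigr => i _ do rewrite gaussE ?mulf_neq0 // qcharM //.
rewrite !big_split /= !prodr_const !card_ord.
have dbl x : x ^+ m.*2 = (x ^+ 2) ^+ m :> algC by rewrite -mul2n exprM.
rewrite !dbl qchar_sqr expr1n mul1r gauss1_sqr exprMn qcharM ?expf_neq0 // qcharX // qchar_prod //; ring.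
Qed.

(* Diagonalizing both H and A turns the sum into a product of one-variable
   Gauss sums. *)
Lemma sum_psi_trace m k (H : 'M[F]_k) (A : 'M[F]_(m.*2)) :
    H^T = H -> A^T = A -> \det A != 0 ->
  \sum_(M : 'M_(m.*2, k)) psi (\tr (H *m (M^T *m A *m M)))
    = (qchar ((-1) ^+ m * \det A) * q ^+ m) ^+ \rank H * (q ^+ m.*2) ^+ (k - \rank H).
Proof.
move=> symH symA detA.
have [L L_unit [d HE]] := sym_diagonalizable two_neq0 symH.
have [K K_unit [e AE]] := sym_diagonalizable two_neq0 symA.
have detAE : \det A = \det K ^+ 2 * \prod_i e 0 i.
  by rewrite AE !det_mulmx det_tr det_diag; ring.
have detK : \det K != 0 by rewrite -unitfE -unitmxE.
have pe0 : \prod_i e 0 i != 0.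
  by apply: contraNneq detA => pe; rewrite detAE pe mulr0.
have e0 i : e 0 i != 0 by apply: (prodf_neq0 _ _ pe0).
have qcE : qchar ((-1) ^+ m * \det A) = qchar ((-1) ^+ m * \prod_i e 0 i).
  rewrite detAE mulrCA qcharM ?mulf_neq0 ?expf_neq0 ?oppr_eq0 ?oner_neq0 //.
  by rewrite qcharX // qchar_sqr mul1r.
have rkH : \rank H = (\sum_j (d 0 j != 0)%R)%N.
  by rewrite HE mxrankMfree ?row_free_unit // eqmxMfull ?row_full_unit ?unitmx_tr ?rank_diag_mx.
(* In the coordinates Y = K M L^T the trace is a diagonal form in the entries of Y, with
   coefficients d_j e_i. *)
have trE (M : 'M_(m.*2, k)) : \tr (H *m (M^T *m A *m M))
    = \sum_j \sum_i d 0 j * e 0 i * (K *m M *m L^T) i j ^+ 2.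
  pose Y := K *m M *m L^T.
  transitivity (\tr (diag_mx d *m (Y^T *m (diag_mx e *m Y)))).
    by rewrite HE AE -!mulmxA mxtrace_mulC /Y !trmx_mul trmxK !mulmxA.
  apply: eq_bigr => j _; rewrite mul_diag_mx mxE mxE big_distrr; apply: eq_bigr => i _ /=.
  rewrite mul_diag_mx -/Y; move: Y => Y; by rewrite !mxE; ring.
pose f (M : 'M_(m.*2, k)) := K *m M *m L^T.
have f_bij : bijective f.
  exists (fun Y => invmx K *m Y *m invmx L^T) => M; rewrite /f.
    by rewrite !mulmxA mulVmx // mul1mx mulmxK // unitmx_tr.
  by rewrite !mulmxA mulmxV // mul1mx mulmxKV // unitmx_tr.
transitivity (\sum_(Y : 'M_(m.*2, k)) \prod_j \prod_i psi (d 0 j * e 0 i * Y i j ^+ 2)).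
  rewrite [RHS](reindex f); last exact: onW_bij.
  apply: eq_bigr => M _; rewrite trE psi_sum; apply: eq_bigr => j _.
  by rewrite psi_sum.
transitivity (\prod_j \prod_i gauss (d 0 j * e 0 i)).
  rewrite pair_bigA bigA_distr_bigA /=.
  pose h (t : {ffun 'I_k * 'I_(m.*2) -> F}) : 'M_(m.*2, k) := \matrix_(i, j) t (j, i).
  rewrite (reindex h); last first.
    exists (fun Y : 'M_(m.*2, k) => [ffun p => Y p.2 p.1]) => Y _.
      by apply/ffunP=> -[j i]; rewrite ffunE mxE.
    by apply/matrixP=> i j; rewrite mxE ffunE.
  apply: eq_bigr => t _; rewrite pair_bigA; apply: eq_bigr => -[j i] _ /=.
  by rewrite mxE.
have rk_le : (\sum_j (d 0 j != 0)%R <= k)%N by rewrite -rkH rank_leq_row.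
have -> : (k - \rank H = \sum_j (d 0 j == 0)%R)%N.
  apply/eqP; rewrite rkH -(eqn_add2r (\sum_j (d 0 j != 0)%R)) subnK // -big_split /=.
  by rewrite -{1}(card_ord k) -sum1_card; apply/eqP/eq_bigr => j _; case: eqP.
(* Column j contributes the signed q^m if d_j is nonzero and q^(2m) otherwise; the former columns
   number rank H. *)
rewrite rkH -!prodrXr -big_split; apply: eq_bigr => j _ /=.
have [->|dj] := eqVneq (d 0 j) 0; last by rewrite expr1 expr0 mulr1 prod_gauss // -qcE.
under eq_bigr do rewrite mul0r gauss0.
by rewrite prodr_const card_ord expr0 expr1 mul1r.
Qed.

End GaussSums.

(** * Counting the zeros of bounded degree *)

Section SolutionCount.
Variable F : finFieldType.
Local Notation coefs a := (nth 0 (polyseq (rVpoly a))).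

(** The reading of rows made by [polys_of], for any number of coefficients, 0 included. *)
Definition rows_poly n k (M : 'M[F]_(n, k)) (i : 'I_n) : {poly F} := rVpoly (row i M).

Definition sols n k (A : 'M[F]_n) : {set 'M[F]_(n, k)} :=
  [set M | qform_poly A (rows_poly M) == 0].

Lemma qform_rowsE n k (A : 'M_n) (M : 'M[F]_(n, k)) :
  qform_poly A (rows_poly M) = \sum_a \sum_b (M^T *m A *m M) a b *: 'X^(a + b).
Proof.
transitivity (\sum_i \sum_j \sum_a \sum_b (A i j * M i a * M j b) *: 'X^(a + b)).
  apply: eq_bigr => i _; apply: eq_bigr => j _.
  rewrite /rows_poly !rVpolyE big_distrl scaler_sumr; apply: eq_bigr => a _ /=.
  rewrite big_distrr scaler_sumr; apply: eq_bigr => b _ /=.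
  by rewrite -scalerAl -scalerAr -exprD !scalerA !mxE ?mulrA.
rewrite pair_bigA; under eq_bigr do rewrite pair_bigA.
rewrite exchange_big /= [RHS]pair_bigA; apply: eq_bigr => -[a b] _ /=.
rewrite mxE scaler_suml -(pair_bigA _ (fun i j => (A i j * M i a * M j b) *: 'X^(a + b))) exchange_big.
apply: eq_bigr => j _ /=; rewrite mxE big_distrl scaler_suml.
by apply: eq_bigr => i _ /=; rewrite mxE [A i j * _]mulrC.
Qed.

Lemma size_qform_rows n k (A : 'M_n) (M : 'M[F]_(n, k.+1)) :
  (size (qform_poly A (rows_poly M)) <= k.*2.+1)%N.
Proof.
rewrite qform_rowsE; apply: (big_ind (fun p : {poly F} => size p <= k.*2.+1)%N).
- by rewrite size_poly0.
- by move=> p r sp sr; rewrite (leq_trans (size_polyD _ _)) // geq_max sp.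
move=> a _; apply: (big_ind (fun p : {poly F} => size p <= k.*2.+1)%N).
- by rewrite size_poly0.
- by move=> p r sp sr; rewrite (leq_trans (size_polyD _ _)) // geq_max sp.
move=> b _; rewrite (leq_trans (size_scale_leq _ _)) // size_polyXn.
by have := ltn_ord a; have := ltn_ord b; lia.
Qed.

(** The coefficients of f(x) are antidiagonal sums of the Gram matrix [M^T *m A *m M], and a Hankel
    matrix is constant along antidiagonals. *)
Lemma sum_coef_qform n k (A : 'M_n) (M : 'M[F]_(n, k.+1)) (a : 'rV_(k.*2.+1)) :
  \sum_l a 0 l * (qform_poly A (rows_poly M))`_l
    = \tr (hankel k.+1 k.+1 (coefs a) *m (M^T *m A *m M)).
Proof.
rewrite qform_rowsE.
transitivity (\sum_i \sum_j (M^T *m A *m M) i j * coefs a (i + j)%N); last first.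
  rewrite exchange_big; apply: eq_bigr => j _; rewrite mxE; apply: eq_bigr => i _.
  by rewrite [hankel _ _ _ _ _]mxE mulrC addnC.
under eq_bigr => l _ do rewrite coef_sum mulr_sumr.
rewrite exchange_big; apply: eq_bigr => i _ /=.
under eq_bigr => l _ do rewrite coef_sum mulr_sumr.
rewrite exchange_big; apply: eq_bigr => j _ /=.
have ijN : (i + j < k.*2.+1)%N by have := ltn_ord i; have := ltn_ord j; lia.
rewrite (bigD1 (Ordinal ijN)) //= coefZ coefXn eqxx mulr1 big1 ?addr0 => [|l /eqP nl].
  by rewrite mulrC -(coef_rVpoly_ord a (Ordinal ijN)).
rewrite coefZ coefXn (_ : (l == _ :> nat) = false) ?mulr0 //.
by apply/eqP=> e; case: nl; apply/val_inj.
Qed.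

(** The sum factors over the coordinates of [a], each factor being q or 0 by [sum_psiM]. *)
Lemma sum_psi_dual (psi : F -> algC) N (c : 'I_N -> F) :
    psi 0 = 1 -> {morph psi : a b / a + b >-> a * b} -> \sum_a psi a = 0 ->
  \sum_(a : 'rV_N) psi (\sum_l a 0 l * c l)
    = if [forall l, c l == 0] then #|F|%:R ^+ N else 0.
Proof.
move=> psi0 psiD psiS.
transitivity (\prod_l \sum_a psi (a * c l)).
  rewrite bigA_distr_bigA /=.
  pose h (t : {ffun 'I_N -> F}) : 'rV_N := \row_l t l.
  rewrite (reindex h); last first.
    exists (fun a : 'rV_N => [ffun l => a 0 l]) => a _.
      by apply/ffunP=> l; rewrite ffunE mxE.
    by apply/rowP=> l; rewrite mxE ffunE.
  apply: eq_bigr => t _; rewrite (psi_sum psi0 psiD); apply: eq_bigr => l _.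
  by rewrite mxE.
under eq_bigr do rewrite sum_psiM //.
case: ifPn => [/forallP c0|]; last first.
  rewrite negb_forall => /existsP[l /negPf cl].
  by apply/eqP/prodf_eq0; exists l; rewrite // cl.
by rewrite (eq_bigr (fun=> #|F|%:R)) ?prodr_const ?card_ord // => l _; rewrite c0.
Qed.

Lemma card_sols_hankel m k (A : 'M[F]_(m.*2)) :
    2%:R != 0 :> F -> A^T = A -> \det A != 0 -> ~~ issq ((-1) ^+ m * \det A) ->
  (#|F| ^ k.*2.+1 * #|sols k.+1 A|)%:R
    = \sum_(a : 'rV[F]_(k.*2.+1)) let r := \rank (hankel k.+1 k.+1 (coefs a)) in
        (- #|F|%:R ^+ m) ^+ r * (#|F|%:R ^+ m.*2) ^+ (k.+1 - r) :> int.
Proof.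
move=> two0 symA detA nsq.
have [psi [psi0 psiD psiS]] := nontrivial_additive_character F.
(* Both sides are integers, compared in [algC] where the character takes its values. *)
apply: (@intr_inj algC); rewrite rmorph_sum /= rmorph_nat.
transitivity (\sum_(a : 'rV[F]_(k.*2.+1)) \sum_(M : 'M_(m.*2, k.+1))
    psi (\sum_l a 0 l * (qform_poly A (rows_poly M))`_l)).
  (* For fixed [M] the sum over [a] detects the vanishing of the first 2k+1 coefficients of f(x); by
     [size_qform_rows] the others are zero. *)
  rewrite exchange_big /= natrM natrX mulrC -sum1_card natr_sum big_distrl big_mkcond /=.
  apply: eq_bigr => M _; rewrite sum_psi_dual // inE mul1r.
  congr (if _ then _ else _); apply/eqP/forallP => [-> l|c0]; first by rewrite coef0.
  apply/polyP=> l; rewrite coef0; have [lt_l|le_l] := ltnP l k.*2.+1.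
    by apply/eqP; apply: c0 (Ordinal lt_l).
  by rewrite nth_default // (leq_trans (size_qform_rows _ _)).
apply: eq_bigr => a _.
under eq_bigr do rewrite sum_coef_qform.
rewrite (sum_psi_trace two0 psi0 psiD psiS) ?tr_hankel // /qchar nsq expr1 mulN1r.
by rewrite rmorphM /= !rmorphXn /= rmorphN !rmorphXn /= rmorph_nat.
Qed.

End SolutionCount.

(** Summation by parts: the rank counts are known in cumulative form. *)
Lemma sum_by_cumulative (R : pzRingType) (T : finType) (rho : T -> nat) K (phi : nat -> R) :
    (forall x, rho x <= K)%N ->
  \sum_x phi (rho x)
    = phi K *+ #|T| + \sum_(r < K) (phi r - phi r.+1) *+ #|[set x | (rho x <= r)%N]|.
Proof.
move=> rhoK; have E x : phi (rho x)
    = phi K + \sum_(r < K) (phi r - phi r.+1) *+ (rho x <= r)%N.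
  rewrite -(big_mkord xpredT (fun r => (phi r - phi r.+1) *+ (rho x <= r)%N)).
  rewrite (big_cat_nat (n := rho x)) //= big_nat big1 => [|r /andP[_ lt_r]]; last first.
    by rewrite leqNgt lt_r.
  have -> : \sum_(rho x <= r < K) (phi r - phi r.+1) *+ (rho x <= r)%N
      = \sum_(rho x <= r < K) - (phi r.+1 - phi r).
    by apply: eq_big_nat => r /andP[-> _]; rewrite opprB.
  by rewrite add0r sumrN telescope_sumr // opprB addrC subrK.
rewrite (eq_bigr _ (fun x _ => E x)) big_split /= sumr_const exchange_big /=.
congr (_ + _); apply: eq_bigr => r _.
rewrite sumrMnr -sum1dep_card [in RHS]big_mkcond; congr (_ *+ _); apply: eq_bigr => x _.
Qed.

(** * Closed formula for the number of zeros of bounded degree *)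

Section SolutionFormula.
Variables (F : finFieldType) (m : nat) (A : 'M[F]_(m.*2)).
Hypothesis two_neq0 : 2%:R != 0 :> F.
Hypotheses (symA : A^T = A) (detA : \det A != 0).
Hypothesis nsq : ~~ issq ((-1) ^+ m * \det A).
Local Notation q := (#|F|%:R : rat).
Local Notation Y := (q ^+ m).

(** Summation by parts against the counts q^(2r) leaves a geometric sum of ratio -q^2 / Y, whence
    the factor Y + q^2. *)
Lemma card_sols_formula k :
  (#|sols k A|)%:R * (Y + q ^+ 2)
    = q * (Y + 1) * (Y ^+ 2 / q ^+ 2) ^+ k + (q - 1) * (q - Y) * (- Y) ^+ k.
Proof.
have q_gt0 : 0 < q by rewrite ltr0n ltnW // finNzRing_gt1.
have Y_gt0 : 0 < Y by rewrite exprn_gt0.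
have q0 : q != 0 by rewrite gt_eqF.
have Y0 : Y != 0 by rewrite gt_eqF.
(* Without coefficients there is only the zero vector; the Hankel matrices below have size at least
   1. *)
case: k => [|k].
  rewrite (_ : sols 0 A = setT); last first.
    apply/setP=> M; rewrite !inE; apply/eqP/big1 => i _; apply: big1 => j _.
    by rewrite /rows_poly [row i M]thinmx0 linear0 mul0r scaler0.
  by rewrite cardsT card_mx muln0 expn0 !expr0; ring.
(* The factor y^2 + z^2 y turns the geometric sum into a difference of powers, so that no division
   occurs over the integers. *)
have key : let z := #|F|%:R : int in let y := z ^+ m in
    z ^+ k.*2.+1 * (#|sols k.+1 A|)%:R * (y ^+ 2 + z ^+ 2 * y)
      = z ^+ k.*2.+1 * (- y) ^+ k.+1 * (y ^+ 2 + z ^+ 2 * y)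
        + (y ^+ 2 + y) * ((y ^+ 2) ^+ k.+1 - (- (z ^+ 2 * y)) ^+ k.+1).
  move=> z y; rewrite -natrX -natrM card_sols_hankel //=.
  rewrite (@sum_by_cumulative _ _
    (fun a => \rank (hankel k.+1 k.+1 (nth 0 (polyseq (rVpoly a))))) k.+1
    (fun r => (- y) ^+ r * (z ^+ m.*2) ^+ (k.+1 - r))); last by move=> a; apply: rank_leq_row.
  have -> : z ^+ m.*2 = y ^+ 2 by rewrite -exprM muln2.
  rewrite card_rV subnn expr0 mulr1 subrXX mulrDl; congr (_ + _).
    by rewrite -[_ *+ (_ ^ _)%N]mulr_natl natrX.
  rewrite opprK mulrC mulrCA; congr (_ * _); rewrite mulr_sumr; apply: eq_bigr => r _.
  have rk : (r <= k)%N by rewrite -ltnS.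
  rewrite card_hankel_rank_le // subSS subSn //=.
  rewrite -[_ *+ (_ ^ _)%N]mulr_natl natrX -/z -mul2n exprM -[- (z ^+ 2 * y)]mulrN [(z ^+ 2 * - y) ^+ r]exprMn.
  rewrite [(- y) ^+ r.+1]exprS [(y ^+ 2) ^+ (k - r).+1]exprS; ring.
have /= := congr1 (fun z : int => z%:~R : rat) key.
rewrite !(rmorphM, rmorphD, rmorphB, rmorphN, rmorphXn, rmorph_nat) /=.
rewrite -[in X in X -> _]mul2n exprS exprM; set S := (#|sols _ _|)%:R => e.
have c0 : q * (q ^+ 2) ^+ k * Y != 0 by rewrite !mulf_neq0 ?expf_neq0.
apply: (mulfI c0); rewrite expr_div_n.
transitivity (q * (q ^+ 2) ^+ k * S * (Y ^+ 2 + q ^+ 2 * Y)); first by ring.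
rewrite e -[- (q ^+ 2 * Y)]mulrN [(q ^+ 2 * - Y) ^+ k.+1]exprMn.
rewrite [(q ^+ 2) ^+ k.+1]exprS [(Y ^+ 2) ^+ k.+1]exprS [(- Y) ^+ k.+1]exprS.
have : (q ^+ 2) ^+ k != 0 by rewrite !expf_neq0.
move: ((Y ^+ 2) ^+ k) ((- Y) ^+ k) ((q ^+ 2) ^+ k) => a b c c_neq0.
by field; rewrite ?c_neq0 ?q0.
Qed.

End SolutionFormula.

(** * Primitive solutions *)

Section MonicGcd.
Variables (F : fieldType) (n : nat).
Implicit Types (x y : 'I_n -> {poly F}) (d h g : {poly F}).

Lemma dvdp_gcd_polys d x : (d %| gcd_polys x) = [forall i, d %| x i].
Proof.
transitivity (\big[andb/true]_(i < n) (d %| x i)); last by rewrite big_andE.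
by apply: (big_morph (fun p => d %| p)) => [p r|]; rewrite ?dvdp0 ?dvdp_gcd.
Qed.

Lemma gcd_polys_dvd x i : gcd_polys x %| x i.
Proof. by have := dvdpp (gcd_polys x); rewrite {1}dvdp_gcd_polys => /forallP. Qed.

(** [gcdp] is determined only up to a unit; the monic choice makes the factorization of [x]
    unique. *)
Definition mgcd x := (lead_coef (gcd_polys x))^-1 *: gcd_polys x.

Lemma mgcd_monic x i : x i != 0 -> mgcd x \is monic.
Proof.
move=> xi; rewrite monicE lead_coefZ mulVf // lead_coef_eq0.
by apply: contraNneq xi => g0; have := gcd_polys_dvd x i; rewrite g0 dvd0p.
Qed.

Lemma size_mgcd x : size (mgcd x) = size (gcd_polys x).
Proof.
have [g0|g0] := eqVneq (gcd_polys x) 0; first by rewrite /mgcd g0 scaler0 ?eqpxx.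
by rewrite size_scale // invr_eq0 lead_coef_eq0.
Qed.

Lemma mgcd_eqp x : mgcd x %= gcd_polys x.
Proof.
have [g0|g0] := eqVneq (gcd_polys x) 0; first by rewrite /mgcd g0 scaler0 ?eqpxx.
by rewrite eqp_scale // invr_eq0 lead_coef_eq0.
Qed.

Lemma mgcdK x i : x i = mgcd x * (x i %/ mgcd x).
Proof.
by rewrite mulrC divpK // (eqp_dvdl _ (mgcd_eqp x)) gcd_polys_dvd.
Qed.

(** Since [h] divides the gcd of [x], it can be cancelled, and the remaining cofactor divides every
    [y i]. *)
Lemma gcd_polys_mul h x y : (forall i, x i = h * y i) ->
  gcd_polys x %= h * gcd_polys y.
Proof.
move=> xE; have [h0|h0] := eqVneq h 0.
  rewrite h0 mul0r eqp0 -dvd0p dvdp_gcd_polys; apply/forallP=> i.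
  by rewrite xE h0 mul0r.
have /dvdpP[e eE] : h %| gcd_polys x.
  by rewrite dvdp_gcd_polys; apply/forallP=> i; rewrite xE dvdp_mulr.
apply/andP; split; last first.
  rewrite dvdp_gcd_polys; apply/forallP=> i; by rewrite xE dvdp_mul2l // gcd_polys_dvd.
rewrite eE mulrC dvdp_mul2l // dvdp_gcd_polys; apply/forallP=> i.
by have := gcd_polys_dvd x i; rewrite eE xE mulrC dvdp_mul2l.
Qed.

(** Uniqueness of the factorization into a monic polynomial and a primitive vector. This makes
    raising and lowering the gcd mutually inverse. *)
Lemma mgcd_factor h x y : (forall i, x i = h * y i) -> h \is monic ->
  size (gcd_polys y) == 1%N -> mgcd x = h /\ forall i, x i %/ mgcd x = y i.
Proof.
move=> xE hm; rewrite size_poly_eq1 => y1.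
have gh : gcd_polys x %= h.
  apply: eqp_trans (gcd_polys_mul xE) _; rewrite -[X in _ %= X]mulr1.
  exact: eqp_mull.
have gx0 : gcd_polys x != 0 by rewrite -size_poly_eq0 (eqp_size gh) size_poly_eq0 monic_neq0.
have e : mgcd x = h.
  apply/eqP; rewrite -eqp_monic //; last first.
    by rewrite monicE lead_coefZ mulVf // lead_coef_eq0.
  exact: eqp_trans (mgcd_eqp x) gh.
by split=> // i; rewrite e xE mulrC mulpK // monic_neq0.
Qed.

Lemma prim_mgcd x i : x i != 0 -> size (gcd_polys (fun i => x i %/ mgcd x)) == 1%N.
Proof.
move=> xi; have gm := mgcd_monic xi.
have e := gcd_polys_mul (mgcdK x); have := eqp_trans (mgcd_eqp x) e.
rewrite -{1}[mgcd x]mulr1 eqp_mul2l ?monic_neq0 // size_poly_eq1.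
by rewrite eqp_sym.
Qed.

(** For k > 0: the maximal degree is exactly k - 1. *)
Definition maxsize x k := [forall i, (size (x i) <= k)%N] && [exists i, size (x i) == k].

(** Nonzero entries gain one in size and zero entries keep size 0; as [k] is positive, a zero entry
    never attains the maximum. *)
Lemma maxsize_mul h g x y z k : (0 < k)%N -> h != 0 -> size g = (size h).+1 ->
  (forall i, x i = h * z i) -> (forall i, y i = g * z i) ->
  maxsize y k.+1 = maxsize x k.
Proof.
move=> k0 h0 sg xE yE; have g0 : g != 0 by rewrite -size_poly_eq0 sg.
have sE i : size (y i) = if z i == 0 then 0%N else (size (x i)).+1.
  rewrite xE yE; case: eqP => [->|/eqP z0]; first by rewrite mulr0 size_poly0.
  rewrite !size_mul // sg addSn /= prednK //.
  by rewrite addn_gt0 size_poly_gt0 h0.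
have xz i : z i = 0 -> size (x i) = 0%N by move=> z0; rewrite xE z0 mulr0 size_poly0.
congr (_ && _).
  by apply: eq_forallb => i; rewrite sE; case: (z i =P 0) => [/xz ->|].
apply: eq_existsb => i; rewrite sE; case: (z i =P 0) => [/xz ->|//].
by rewrite eq_sym; case: k k0.
Qed.

End MonicGcd.

Lemma qform_poly_mul (F : fieldType) n (A : 'M[F]_n) h (x y : 'I_n -> {poly F}) :
  (forall i, x i = h * y i) -> qform_poly A x = h ^+ 2 * qform_poly A y.
Proof.
move=> xE; rewrite /qform_poly mulr_sumr; apply: eq_bigr => i _.
rewrite mulr_sumr; apply: eq_bigr => j _; rewrite !xE -scalerAr; congr (_ *: _).
by ring.
Qed.

(** * Raising and lowering the degree of the gcd *)

Lemma drop_poly1E (R : nzRingType) (g : {poly R}) : g = drop_poly 1 g * 'X + (g`_0)%:P.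
Proof.
apply/polyP=> -[|i]; rewrite coefD coefMX coefC /= ?add0r //.
by rewrite coef_drop_poly addn1 addr0.
Qed.

Lemma drop_poly1_MXaddC (R : nzRingType) (g : {poly R}) c : drop_poly 1 (g * 'X + c%:P) = g.
Proof. by apply/polyP=> i; rewrite coef_drop_poly addn1 coefD coefMX coefC addr0. Qed.

Lemma coef0_MXaddC (R : nzRingType) (g : {poly R}) c : (g * 'X + c%:P)`_0 = c.
Proof. by rewrite coefD coefMX coefC add0r. Qed.

Lemma size_monicMXaddC (R : nzRingType) (g : {poly R}) c : g \is monic ->
  size (g * 'X + c%:P) = (size g).+1.
Proof. by move=> gm; rewrite size_MXaddC (negPf (monic_neq0 gm)). Qed.

Lemma monicMXaddC (R : nzRingType) (g : {poly R}) c : g != 0 ->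
  (g * 'X + c%:P \is monic) = (g \is monic).
Proof.
move=> g0; have sg : (0 < size g)%N by rewrite size_poly_gt0.
rewrite !monicE !lead_coefE size_MXaddC (negPf g0) /= coefD coefMX coefC.
by case: (size g) sg => //= k _; rewrite addr0.
Qed.

Section PrimitiveCount.
Variables (F : finFieldType) (n N : nat) (A : 'M[F]_n).
Implicit Types x y : 'I_n -> {poly F}.

Definition mx_of_polys (x : 'I_n -> {poly F}) : 'M[F]_(n, N) := \matrix_(i, j) (x i)`_j.

Lemma coef_rows_poly k (M : 'M[F]_(n, k)) i (j : 'I_k) : (rows_poly M i)`_j = M i j.
Proof. by rewrite coef_rVpoly_ord mxE. Qed.

Lemma size_rows_poly k (M : 'M[F]_(n, k)) i : (size (rows_poly M i) <= k)%N.
Proof. exact: size_poly. Qed.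

Lemma mx_of_polysK x i : (size (x i) <= N)%N -> rows_poly (mx_of_polys x) i = x i.
Proof.
move=> sx; apply/polyP=> j; have [jN|Nj] := ltnP j N.
  by rewrite (coef_rows_poly _ _ (Ordinal jN)) mxE.
by rewrite !nth_default // ?(leq_trans sx) // (leq_trans (size_rows_poly _ _)).
Qed.

Lemma rows_polyK (M : 'M[F]_(n, N)) x : (forall i, rows_poly M i = x i) -> mx_of_polys x = M.
Proof. by move=> Mx; apply/matrixP=> i j; rewrite mxE -Mx coef_rows_poly. Qed.

(** The width [N] is kept apart from the size [s], so that solutions of consecutive degrees share
    one matrix type. *)
Definition exact_sols s : {set 'M[F]_(n, N)} :=
  [set M | (qform_poly A (rows_poly M) == 0) && maxsize (rows_poly M) s].

Definition cofactor (M : 'M[F]_(n, N)) i := rows_poly M i %/ mgcd (rows_poly M) : {poly F}.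

(** Sends (c, g y), with g the monic gcd, to (t g + c) y. Every nonconstant monic polynomial is t g
    + c for a unique monic g and a unique c. *)
Definition raise_gcd (cM : F * 'M[F]_(n, N)) :=
  mx_of_polys (fun i => (mgcd (rows_poly cM.2) * 'X + cM.1%:P) * cofactor cM.2 i).

Definition lower_gcd (M : 'M[F]_(n, N)) :=
  ((mgcd (rows_poly M))`_0,
   mx_of_polys (fun i => drop_poly 1 (mgcd (rows_poly M)) * cofactor M i)).

Lemma exact_sols_monic s M : (0 < s)%N -> M \in exact_sols s ->
  mgcd (rows_poly M) \is monic /\ size (gcd_polys (cofactor M)) == 1%N.
Proof.
move=> s0; rewrite inE => /and3P[_ _ /existsP[i /eqP si]].
have Mi : rows_poly M i != 0 by rewrite -size_poly_gt0 si.
by split; [apply: mgcd_monic Mi | apply: prim_mgcd Mi].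
Qed.

Lemma exact_sols_raise s (g0 g1 : {poly F}) y (M0 M1 : 'M[F]_(n, N)) : (0 < s)%N ->
    g0 != 0 -> size g1 = (size g0).+1 ->
    (forall i, rows_poly M0 i = g0 * y i) -> (forall i, rows_poly M1 i = g1 * y i) ->
  (M1 \in exact_sols s.+1) = (M0 \in exact_sols s).
Proof.
move=> s0 g00 sg E0 E1; rewrite !inE (maxsize_mul s0 g00 sg E0 E1); congr (_ && _).
rewrite (qform_poly_mul A E0) (qform_poly_mul A E1) !(mulf_eq0 (_ ^+ 2)) !sqrf_eq0 (negPf g00).
by rewrite -size_poly_eq0 sg.
Qed.

(** As s < N, the raised entries still fit, so [mx_of_polys] truncates nothing. *)
Lemma rows_poly_raise s cM i : (0 < s < N)%N -> cM.2 \in exact_sols s ->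
  rows_poly (raise_gcd cM) i = (mgcd (rows_poly cM.2) * 'X + cM.1%:P) * cofactor cM.2 i.
Proof.
case: cM => c M /andP[s0 sN] /= Ms; rewrite mx_of_polysK //.
have [gm _] := exact_sols_monic s0 Ms.
move: Ms; rewrite inE => /and3P[_ /forallP/(_ i) Ms _].
have [->|y0] := eqVneq (cofactor M i) 0; first by rewrite mulr0 size_poly0.
have gX0 : mgcd (rows_poly M) * 'X + c%:P != 0.
  by rewrite -size_poly_eq0 size_monicMXaddC.
rewrite size_mul // size_monicMXaddC // addSn /=.
move: Ms; rewrite [rows_poly M i]mgcdK (size_mul (monic_neq0 gm) y0) => Ms.
by apply: leq_trans sN; move: Ms; rewrite -/(cofactor M i); case: (_ + _)%N.
Qed.

Lemma rows_poly_lower M i :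
  rows_poly (lower_gcd M).2 i = drop_poly 1 (mgcd (rows_poly M)) * cofactor M i.
Proof.
rewrite mx_of_polysK //; have [->|y0] := eqVneq (cofactor M i) 0.
  by rewrite mulr0 size_poly0.
have [->|g0] := eqVneq (drop_poly 1 (mgcd (rows_poly M))) 0.
  by rewrite mul0r size_poly0.
rewrite size_mul // (leq_trans _ (size_rows_poly M i)) // [rows_poly M i]mgcdK.
have m0 : mgcd (rows_poly M) != 0 by apply: contraNneq g0 => ->; rewrite drop_poly0r.
rewrite size_mul // size_drop_poly -!subn1 leq_sub2r // leq_add2r; exact: leq_subr.
Qed.

Lemma raise_gcdK s cM : (0 < s < N)%N -> cM.2 \in exact_sols s ->
  [/\ lower_gcd (raise_gcd cM) = cM, raise_gcd cM \in exact_sols s.+1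
    & size (gcd_polys (rows_poly (raise_gcd cM))) != 1%N].
Proof.
case: cM => c M sN /= Ms; have [s0 _] := andP sN.
have [gm prim] := exact_sols_monic s0 Ms.
pose g1 := mgcd (rows_poly M) * 'X + c%:P.
have g1m : g1 \is monic by rewrite monicMXaddC // monic_neq0.
have E1 i : rows_poly (raise_gcd (c, M)) i = g1 * cofactor M i by exact: (@rows_poly_raise s (c, M) i sN Ms).
have [gE yE] := mgcd_factor E1 g1m prim.
split.
- rewrite /lower_gcd gE coef0_MXaddC drop_poly1_MXaddC; congr pair.
  by apply: rows_polyK => i; rewrite /cofactor yE -mgcdK.
- rewrite (exact_sols_raise s0 (monic_neq0 gm) _ (mgcdK _) E1) //.
  by rewrite size_monicMXaddC.
rewrite -size_mgcd gE size_monicMXaddC // eqSS size_poly_eq0; exact: monic_neq0.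
Qed.

Lemma lower_gcdK s M : (0 < s)%N -> M \in exact_sols s.+1 ->
    size (gcd_polys (rows_poly M)) != 1%N ->
  raise_gcd (lower_gcd M) = M /\ (lower_gcd M).2 \in exact_sols s.
Proof.
move=> s0 Ms; rewrite -size_mgcd => sg.
have [gm prim] := exact_sols_monic (ltn0Sn _) Ms.
set g := mgcd (rows_poly M) in sg gm.
(* The monic gcd is not 1, so it has size at least 2 and survives the loss of its constant term. *)
have g'0 : drop_poly 1 g != 0.
  have := monic_neq0 gm.
  by rewrite -!size_poly_gt0 size_drop_poly; move: sg; case: (size g) => [|[|k]].
have gE := drop_poly1E g.
have g'm : drop_poly 1 g \is monic by rewrite gE monicMXaddC in gm.
have E0 := rows_poly_lower M.
have [hE yE] := mgcd_factor E0 g'm prim.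
split; last first.
  rewrite -(exact_sols_raise s0 g'0 _ E0 (mgcdK _)) // -/g {1}gE.
  exact: size_monicMXaddC.
apply: rows_polyK => i; rewrite /= hE -gE /cofactor yE; exact: mgcdK.
Qed.

(** The left side is the image of F x [exact_sols s] under [raise_gcd], which [lower_gcd]
    inverts. *)
Lemma card_imprimitive s : (0 < s < N)%N ->
  #|[set M in exact_sols s.+1 | size (gcd_polys (rows_poly M)) != 1%N]|
    = (#|F| * #|exact_sols s|)%N.
Proof.
move=> sN; have [s0 _] := andP sN.
rewrite -[#|F|]cardsT -cardsX.
have injR : {in setX [set: F] (exact_sols s) &, injective raise_gcd}.
  apply: (can_in_inj (g := lower_gcd)) => cM; rewrite inE => /andP[_ Ms].
  by have [] := raise_gcdK sN Ms.
rewrite -(card_in_imset injR); apply: eq_card => M; rewrite inE.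
apply/andP/imsetP => [[Ms sg]|[cM]].
  have [RL Ls] := lower_gcdK s0 Ms sg.
  by exists (lower_gcd M); rewrite ?RL // inE inE.
by rewrite inE => /andP[_ Ms] ->; have [] := raise_gcdK sN Ms.
Qed.

(** Padding with zero columns identifies width [s] with the part of width [N] of size at most
    [s]. *)
Lemma card_bounded_sols s : (s <= N)%N ->
  #|[set M in sols N A | [forall i, (size (rows_poly M i) <= s)%N]]| = #|sols s A|.
Proof.
move=> sN; pose up (M : 'M[F]_(n, s)) := mx_of_polys (rows_poly M).
have upE M i : rows_poly (up M) i = rows_poly M i.
  by rewrite mx_of_polysK // (leq_trans (size_rows_poly _ _)).
have inj_up : injective up.
  move=> M M' eM; apply/matrixP=> i j.
  by rewrite -!coef_rows_poly -!upE eM.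
have qE M : qform_poly A (rows_poly (up M)) = qform_poly A (rows_poly M).
  by apply: eq_bigr => i _; apply: eq_bigr => j _; rewrite !upE.
rewrite -(card_imset _ inj_up); apply: eq_card => M; rewrite !inE.
apply/andP/imsetP => [[fM /forallP Ms]|[M' fM' ->]]; last first.
  rewrite qE; split; first by rewrite inE in fM'.
  by apply/forallP=> i; rewrite upE size_rows_poly.
have uM : up (\matrix_(i, j) (rows_poly M i)`_j) = M.
  apply: rows_polyK => i; apply/polyP=> j; have [js|sj] := ltnP j s.
    by rewrite (coef_rows_poly _ _ (Ordinal js)) mxE.
  by rewrite !nth_default ?(leq_trans (Ms i) sj) ?(leq_trans (size_rows_poly _ _) sj).
by exists (\matrix_(i, j) (rows_poly M i)`_j); rewrite // inE -qE uM.
Qed.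

Lemma card_exact_sols s : (s < N)%N ->
  (#|exact_sols s.+1| + #|sols s A| = #|sols s.+1 A|)%N.
Proof.
move=> sN; rewrite -(card_bounded_sols (ltnW sN)) -(card_bounded_sols sN).
set T0 := [set _ in _ | _]; set T1 := [set _ in _ | _].
have sT : T0 \subset T1.
  apply/subsetP=> M; rewrite !inE => /andP[-> /forallP Ms].
  by apply/forallP=> i; apply: leqW.
rewrite -(cardsID T0 T1) (setIidPr sT) addnC; congr (_ + _)%N; apply: eq_card => M.
rewrite !inE /maxsize; case: (qform_poly _ _ == 0); rewrite ?andbF //=.
rewrite andbC; apply: andb_id2r => /forallP Ms; rewrite negb_forall.
by apply: eq_existsb => i; rewrite -ltnNge eqn_leq Ms.
Qed.

End PrimitiveCount.

(** The order of the additive group kills 1; if it is odd and 2 = 0, then 1 = 0. *)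
Lemma odd_card_two_neq0 (F : finFieldType) : odd #|F| -> 2%:R != 0 :> F.
Proof.
move=> oddF; apply/eqP => two0.
have : (1 : F) *+ #|F| = 0.
  by rewrite -FinRing.zmodXgE -cardsT expg_cardG ?inE.
rewrite -(odd_double_half #|F|) oddF mulrnDr -mul2n mulrnA two0 mul0rn addr0.
exact/eqP/oner_neq0.
Qed.

(** * From primitive solutions to morphisms *)

Section MorphismCount.
Variables (F : finFieldType) (n P : nat) (A : 'M[F]_n).

Lemma polys_ofE (M : 'M[F]_(n, P.+1)) i : polys_of M i = rows_poly M i.
Proof.
apply/polyP=> j; rewrite coef_poly; case: ltnP => [jP|Pj].
  by rewrite (coef_rows_poly M i (Ordinal jP)); congr (M _ _); apply/val_inj; rewrite /= inordK.
by rewrite nth_default // (leq_trans (size_rows_poly _ _)).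
Qed.

Lemma is_mor_vecE (M : 'M[F]_(n, P.+1)) :
  is_mor_vec A M = (M \in exact_sols P.+1 A P.+1) && (size (gcd_polys (rows_poly M)) == 1%N).
Proof.
rewrite inE /is_mor_vec /maxsize.
have -> : gcd_polys (polys_of M) = gcd_polys (rows_poly M).
  by apply: eq_bigr => i _; apply: polys_ofE.
have -> : qform_poly A (polys_of M) = qform_poly A (rows_poly M).
  by apply: eq_bigr => i _; apply: eq_bigr => j _; rewrite !polys_ofE.
have -> : [exists i, size (polys_of M i) == P.+1] = [exists i, size (rows_poly M i) == P.+1].
  by apply: eq_existsb => i; rewrite polys_ofE.
have -> : [forall i, (size (rows_poly M i) <= P.+1)%N].
  by apply/forallP=> i; apply: size_rows_poly.
by rewrite andTb andbC [X in X && _]andbC.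
Qed.

Lemma card_mor_vec : (0 < P)%N ->
  (#|[set M : 'M[F]_(n, P.+1) | is_mor_vec A M]| + #|F| * #|exact_sols P.+1 A P|
    = #|exact_sols P.+1 A P.+1|)%N.
Proof.
move=> P0; rewrite -card_imprimitive ?P0 //=.
rewrite -(cardsID [set M | size (gcd_polys (rows_poly M)) == 1%N] (exact_sols P.+1 A P.+1)).
congr (_ + _)%N; apply: eq_card => M; first by rewrite !inE is_mor_vecE inE.
by rewrite !inE andbC.
Qed.

End MorphismCount.

(** The primitive solutions number S_(P+1) - (q+1) S_P + q S_(P-1). Since S_k is a combination of
    Q^k and (-Y)^k, each term z^k becomes z^(P-1) (z-1)(z-q). *)
Lemma num_mor_formula (F : finFieldType) t (A : 'M[F]_(t.+2.*2)) P :
    odd #|F| -> A^T = A -> \det A != 0 -> ~~ issq ((-1) ^+ t.+2 * \det A) -> (0 < P)%N ->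
  let q : rat := #|F|%:R in let Y := q ^+ t.+2 in let Q := q ^+ t.*2.+2 in
  num_mor P A =
    (Y + 1) * (Q - 1) * (q ^+ t.*2.+1 - 1) / (Q * (q ^+ t + 1) * (q - 1)) * Q ^+ P
    + (Q - 1) * (Y + 1) / (Y * (q ^+ t + 1)) * (- Y) ^+ P.
Proof.
case: P => // p oddF symA detA nsq _ q Y Q.
have two0 := odd_card_two_neq0 oddF.
have q1 : 1 < q by rewrite ltr1n finNzRing_gt1.
have q0 : q != 0 by rewrite gt_eqF // (lt_trans ltr01).
have qB1 : q - 1 != 0 by rewrite subr_eq0 gt_eqF.
have u0 : q ^+ t != 0 by rewrite expf_neq0.
have u1 : q ^+ t + 1 != 0.
  by rewrite gt_eqF // addr_gt0 // exprn_gt0 // (lt_trans ltr01).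
have := card_mor_vec A (ltn0Sn p).
have := card_exact_sols A (ltnSn p.+1).
have := card_exact_sols A (ltnW (ltnSn p.+1)).
move=> /(congr1 (fun k => k%:R : rat)) e1 /(congr1 (fun k => k%:R : rat)) e2.
move=> /(congr1 (fun k => k%:R : rat)) e3; move: e1 e2 e3.
have S k := @card_sols_formula F t.+2 A two0 symA detA nsq k.
have YE : Y = q ^+ 2 * q ^+ t by rewrite -exprD.
have QE : Q = q ^+ 2 * (q ^+ t) ^+ 2 by rewrite -exprM muln2 -exprD.
have YQ : Y ^+ 2 / q ^+ 2 = Q by rewrite YE QE; field.
have QqE : q ^+ t.*2.+1 = q * (q ^+ t) ^+ 2 by rewrite -exprM muln2 -exprS.
move: (S p) (S p.+1) (S p.+2).
rewrite /num_mor natrB ?(ltnW (finNzRing_gt1 _)) // -/q -/Y YQ !natrD natrM -/q QqE.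
(* Once the powers with exponent [p], and later [q ^+ t], are abstracted, a rational identity
   remains for [field]. *)
rewrite !(exprS _ p.+1) !(exprS _ p); move: (Q ^+ p) ((- Y) ^+ p) => a b; rewrite QE YE => s0 s1 s2 e1 e2 e3.
apply: (mulIf qB1); rewrite divfK //.
move: (_%:R) e3 => W /(canRL (addrK _)) ->.
rewrite -(addrK (#|sols p.+1 A|%:R : rat) #|exact_sols _ _ p.+2|%:R) e2.
rewrite -(addrK (#|sols p A|%:R : rat) #|exact_sols _ _ p.+1|%:R) e1.
have d0 : q ^+ 2 * q ^+ t + q ^+ 2 != 0.
  by rewrite -[X in _ + X]mulr1 -mulrDr mulf_neq0 ?expf_neq0.
rewrite (canRL (mulfK d0) s0) (canRL (mulfK d0) s1) (canRL (mulfK d0) s2).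
move: (q ^+ t) u0 u1 d0 => u u0 u1 d0.
by field; rewrite u1 u0 q0 qB1 d0.
Qed.

Theorem theorem1p2 (F : finFieldType) (n : nat) (A : 'M[F]_n) (P : nat) :
  odd #|F| ->
  (4 <= n)%N -> ~~ odd n ->
  A^T = A ->
  \det A != 0 ->
  ~ (exists y : F, y ^+ 2 = (-1) ^+ (n./2) * \det A) ->
  (1 <= P)%N ->
  let q : rat := (#|F|)%:R in
  (n = 4%N ->
     num_mor P A = (if ~~ odd P then (q ^+ 4 - 1) / q ^+ 2 * q ^+ (2 * P) else 0)) /\
  ((6 <= n)%N ->
     num_mor P A =
       (q ^+ n./2 + 1) * (q ^+ (n - 2) - 1) * (q ^+ (n - 3) - 1)
         / (q ^+ (n - 2) * (q ^+ (n./2 - 2) + 1) * (q - 1)) * q ^+ (P * (n - 2))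
       + (-1) ^+ P * ((q ^+ (n - 2) - 1) * (q ^+ n./2 + 1))
         / (q ^+ n./2 * (q ^+ (n./2 - 2) + 1)) * q ^+ (n./2 * P)).
Proof.
move=> oddF n4 even_n symA detA nsq P1 q.
have {n4 even_n} [t nE] : exists t, n = t.+2.*2.
  by exists (n./2 - 2)%N; lia.
subst n; rewrite doubleK in nsq *.
have {}nsq : ~~ issq ((-1) ^+ t.+2 * \det A) by apply/negP => /issqP.
have -> := num_mor_formula oddF symA detA nsq P1; rewrite -/q.
have q1 : 1 < q by rewrite ltr1n finNzRing_gt1.
have q0 : q != 0 by rewrite gt_eqF // (lt_trans ltr01).
have qB1 : q - 1 != 0 by rewrite subr_eq0 gt_eqF.
split=> [t0|_].
  (* For n = 4 we have Q = Y = q^2, and the two terms have the same absolute value: they cancel for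
     odd [P] and add up for even [P]. *)
  have {t0} -> : t = 0%N by lia.
  rewrite exprNn -!exprM [(2 * P)%N]mulnC -signr_odd.
  by case: (odd P); rewrite ?expr0 ?expr1 /=; field; rewrite q0 qB1.
have -> : (t.+2.*2 - 2 = t.*2.+2)%N by lia.
have -> : (t.+2.*2 - 3 = t.*2.+1)%N by lia.
have -> : (t.+2 - 2 = t)%N by lia.
rewrite [(P * _)%N]mulnC !exprM [(- q ^+ t.+2) ^+ P]exprNn; congr (_ + _).
by rewrite mulrC -!mulrA; congr (_ * _); rewrite mulrC -!mulrA.
Qed.
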